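(* Let $(E,\mathcal{L})$ be a simple complex of oriented matroids (COM) with set of topes $\mathcal{T}$, and let ${\mathfrak V}$ be its signed Varchenko matrix over the polynomial ring $\mathbb{K}[x_{e^+},x_{e^-} \mid e\in E]$. Then \[ \det({\mathfrak V}) = \prod_{Y\in\mathcal{L}} \bigl(1-a(Y)\bigr)^{b_Y}, \] where $a(Y) := \prod_{e\in z(Y)} x_{e^+}x_{e^-}$ and the $b_Y$ are nonnegative integers.
   Context: Sign vectors: for $X,Y\in\{0,+,-\}^E$ ($E$ finite), the composition is $(X\circ Y)_e = X_e$ if $X_e\neq 0$ and $Y_e$ otherwise; the separator is $S(X,Y)=\{e\in E: X_e=-Y_e\neq 0\}$; the zero set is $z(X)=\{e\in E: X_e=0\}$. A COM is a pair $(E,\mathcal{L})$ with $\mathcal{L}\subseteq\{0,+,-\}^E$ satisfying (FS) face symmetry: $X\circ(-Y)\in\mathcal{L}$ for all $X,Y\in\mathcal{L}$; and (SE) strong elimination: for all $X,Y\in\mathcal{L}$ and $e\in S(X,Y)$ there is $Z\in\mathcal{L}$ with $Z_e=0$ and $Z_f=(X\circ Y)_f$ for all $f\in E\setminus S(X,Y)$. Elements of $\mathcal{L}$ are covectors. The COM is simple if for every $e\in E$, $\{X_e: X\in\mathcal{L}\}=\{+,-,0\}$, and for all $e\neq f$ in $E$, $\{X_eX_f : X\in\mathcal{L}\}=\{+,-,0\}$. Topes are the covectors with no zero entries; $\mathcal{T}$ is the set of topes. The signed Varchenko matrix ${\mathfrak V}$ is the $\#\mathcal{T}\times\#\mathcal{T}$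 matrix, rows and columns indexed by $\mathcal{T}$ in a fixed linear order (the same for rows and columns), with entries ${\mathfrak V}_{P,Q}=\prod_{e\in S(P,Q)} x_{e^{P_e}}$, i.e. the product of $x_{e^+}$ over $e\in S(P,Q)$ with $P_e=+$ and $x_{e^-}$ over $e\in S(P,Q)$ with $P_e=-$; $\mathbb{K}$ is a field. *)

(* Defs.v *)
From HB Require Import structures.
From mathcomp Require Import all_boot all_order all_algebra.
From mathcomp Require Import mpoly.

Set Implicit Arguments.
Unset Strict Implicit.
Unset Printing Implicit Defensive.

Import GRing.Theory.
Local Open Scope ring_scope.

Inductive sign : Type := Zero | Plus | Minus.

Definition option_of_sign (s : sign) : option bool :=
  match s with Zero => None | Plus => Some true | Minus => Some false end.

Definition sign_of_option (o : option bool) : sign :=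
  match o with None => Zero | Some true => Plus | Some false => Minus end.

Lemma option_of_signK : cancel option_of_sign sign_of_option.
Proof. by case. Qed.

HB.instance Definition _ := Countable.copy sign (can_type option_of_signK).
HB.instance Definition _ : isFinite sign := CanIsFinite option_of_signK.

Definition sopp (s : sign) : sign :=
  match s with Zero => Zero | Plus => Minus | Minus => Plus end.

Definition smul (s t : sign) : sign :=
  match s with Zero => Zero | Plus => t | Minus => sopp t end.

Section SignVectors.

Variable E : finType.
Implicit Types (X Y Z P Q : {ffun E -> sign}) (L : {set {ffun E -> sign}}).

Definition svopp X : {ffun E -> sign} := [ffun e => sopp (X e)].

Definition svcomp X Y : {ffun E -> sign} :=
  [ffun e => if X e != Zero then X e else Y e].

Definition separator X Y : {set E} :=
  [set e | (X e == sopp (Y e)) && (X e != Zero)].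

Definition zero_set X : {set E} := [set e | X e == Zero].

Definition face_symmetry L : Prop :=
  forall X Y, X \in L -> Y \in L -> svcomp X (svopp Y) \in L.

Definition strong_elimination L : Prop :=
  forall X Y, X \in L -> Y \in L -> forall e, e \in separator X Y ->
  exists Z, [/\ Z \in L, Z e = Zero
    & forall f, f \notin separator X Y -> Z f = svcomp X Y f].

Definition is_COM L : Prop := face_symmetry L /\ strong_elimination L.

Definition COM_simple L : Prop :=
  (forall e, [set X e | X : {ffun E -> sign} in L]
             = [set Plus; Minus; Zero]) /\
  (forall e f, e != f -> [set smul (X e) (X f) | X : {ffun E -> sign} in L]
                         = [set Plus; Minus; Zero]).

Definition topes L : {set {ffun E -> sign}} :=
  [set X in L | [forall e, X e != Zero]].

Variable K : fieldType.

(* The 2 #|E| indeterminates are numbered through E * bool: (e, true) stands   *)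
(* for e^+ and (e, false) for e^-.                                            *)
Definition xvar (e : E) (b : bool) : {mpoly K[#|{: E * bool}|]} :=
  'X_(enum_rank (e, b)).

(* On the separator P e is never Zero, so P e != Plus means P e = Minus.       *)
Definition varchenko_entry P Q : {mpoly K[#|{: E * bool}|]} :=
  \prod_(e in separator P Q) xvar e (P e == Plus).

(* s lists the topes in the linear order chosen for both rows and columns.     *)
Definition varchenko (s : seq {ffun E -> sign}) :
    'M[{mpoly K[#|{: E * bool}|]}]_(size s) :=
  \matrix_(i, j) varchenko_entry (tnth (in_tuple s) i) (tnth (in_tuple s) j).

Definition face_weight Y : {mpoly K[#|{: E * bool}|]} :=
  \prod_(e in zero_set Y) (xvar e true * xvar e false).

End SignVectors.

(* Main.v *)
(* Let R be the polynomial ring and let V act on functions from topes to R.    *)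
(* It suffices that V becomes invertible once the 1 - a(Y), Y not a tope, are  *)
(* inverted: then det V divides a product of such factors, each of them is     *)
(* prime, and V is the identity matrix at x = 0.                               *)
(*   Invertibility is proved by induction on the number of covectors. Fix an   *)
(* element e that separates two topes, and let L0 be the COM of covectors Y    *)
(* with Y_e = 0, weighted by w(Y) = (-1)^codim. Every subcomplex of L0 fixing  *)
(* some signs has total weight 1, and therefore, for topes P and Q on          *)
(* different sides of e,                                                       *)
(*   V_{P,Q} = sum_(Y in L0) w(Y) V_{P,YoP} V_{YoP,Q}                          *)
(*                           * prod_(f in z(Y), (YoP)_f = Q_f) a_f.            *)
(* As a function of P, the term of Y is generated by columns of V because the  *)
(* matrix of the topes above Y is already known to be invertible.              *)

Require Import Defs.
From HB Require Import structures.
From mathcomp Require Import all_boot all_order all_algebra.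
From mathcomp Require Import mpoly ring.

Set Implicit Arguments.
Unset Strict Implicit.
Unset Printing Implicit Defensive.

Import GRing.Theory.
Local Open Scope ring_scope.

(** * Subcomplexes and Euler weights *)

(** The weights come from [euler_weights]. In the expansion [tope_detour] each term is the entry
    itself times a product ([detourE]), and these products have weighted sum 1. By induction on the
    COM, [columns_generate] then obtains every [delta P] from columns and division by factors 1 -
    a(Y). Clearing denominators gives W such that V W is diagonal with products of factors on the
    diagonal, so det V divides such a product. The factors are prime ([face_factor_prime]), hence
    det V is a unit times some of them ([divisor_of_prime_product]); at x = 0 this unit is seen to
    be 1. *)

Lemma soppK : involutive sopp.
Proof. by case. Qed.

Lemma big_sign (V : nmodType) (F : sign -> V) :
  \sum_s F s = F Zero + F Plus + F Minus.
Proof.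
rewrite (bigD1 Zero) //= (bigD1 Plus) //= (bigD1 Minus) //= big1 => [|[] //].
by rewrite addr0 addrA.
Qed.

Section Covectors.

Variable E : finType.
Implicit Types (X Y Z P Q : {ffun E -> sign}) (L M : {set {ffun E -> sign}}).

Definition face_le Y X := svcomp Y X == X.

Lemma face_leP Y X :
  reflect (forall f, Y f != Zero -> X f = Y f) (face_le Y X).
Proof.
apply: (iffP eqP) => [YX f Yf | YX].
  by rewrite -YX ffunE Yf.
by apply/ffunP => f; rewrite ffunE; case: ifP => // /YX.
Qed.

Definition halfspace (e : E) (s : sign) L := [set X in L | X e == s].

Definition star Y L := [set X in L | face_le Y X].

Definition up_closed M L : Prop := M \subset L /\
  forall Y X, Y \in M -> X \in L -> face_le Y X -> X \in M.

(** Serves as deletion of [e], but keeps the ground set and hence the type of sign vectors. *)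
Definition proj (e : E) X : {ffun E -> sign} :=
  [ffun f => if f == e then Zero else X f].

Definition upd Z (e : E) (s : sign) : {ffun E -> sign} :=
  [ffun f => if f == e then s else Z f].

Lemma COM_comp L X Y : is_COM L -> X \in L -> Y \in L -> svcomp X Y \in L.
Proof.
move=> [FS _] XL YL.
suff -> : svcomp X Y = svcomp X (svopp (svcomp X (svopp Y))).
  exact/FS/FS.
apply/ffunP => f; rewrite !ffunE.
by case: (X f) (Y f) => [] [].
Qed.

Lemma halfspace_COM e s L : is_COM L -> is_COM (halfspace e s L).
Proof.
move=> [FS SE]; split=> X Y; rewrite !inE => /andP[XL /eqP Xe] /andP[YL /eqP Ye].
  rewrite FS //= !ffunE Xe Ye; by case: (s).
move=> f fXY; have [Z [ZL Zf ZXY]] := SE _ _ XL YL _ fXY.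
exists Z; split=> //; rewrite inE ZL /= ZXY.
  by rewrite ffunE Xe Ye; case: (s).
by rewrite inE Xe Ye; case: (s).
Qed.

Lemma star_COM Y L : is_COM L -> is_COM (star Y L).
Proof.
move=> [FS SE].
split=> X X'; rewrite !inE => /andP[XL /face_leP YX] /andP[XL' /face_leP YX'].
  rewrite FS //=; apply/face_leP => f Yf.
  by rewrite ffunE YX // Yf.
move=> f fXX; have [Z [ZL Zf ZXX]] := SE _ _ XL XL' _ fXX.
exists Z; split=> //; rewrite inE ZL /=; apply/face_leP => g Yg.
rewrite ZXX.
  by rewrite ffunE YX // Yg.
by rewrite inE YX // YX' //; case: (Y g) Yg.
Qed.

Lemma proj_COM e L : is_COM L -> is_COM (proj e @: L).
Proof.
move=> [FS SE]; split=> _ _ /imsetP[X XL ->] /imsetP[Y YL ->].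
  apply/imsetP; exists (svcomp X (svopp Y)); first exact: FS.
  by apply/ffunP => f; rewrite !ffunE; case: (f == e).
move=> f; rewrite !inE !ffunE; case: ifP => // fe fXY.
have [|Z [ZL Zf ZXY]] := SE X Y XL YL f; first by rewrite inE.
exists (proj e Z); split; first exact: imset_f.
  by rewrite ffunE fe.
move=> g; rewrite !inE !ffunE; case: ifP => // ge gXY.
by rewrite ZXY ?inE // ffunE.
Qed.

Lemma halfspace_up_closed e s L : s != Zero -> up_closed (halfspace e s L) L.
Proof.
move=> s0; split=> [|Y X]; first by apply/subsetP => X /setIdP[].
rewrite !inE => /andP[_ /eqP Ye] -> /face_leP YX /=.
by rewrite YX Ye.
Qed.

Lemma up_closed_trans L1 L2 L3 :
  up_closed L1 L2 -> up_closed L2 L3 -> up_closed L1 L3.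
Proof.
move=> [s12 u12] [s23 u23]; split; first exact: subset_trans s23.
move=> Y X Y1 X3 YX; apply: (u12 Y) => //; apply: (u23 Y) => //.
exact: (subsetP s12).
Qed.

Lemma proj_upd e s Z : proj e (upd Z e s) = proj e Z.
Proof. by apply/ffunP => f; rewrite !ffunE; case: eqP. Qed.

Lemma upd_proj e Y : upd (proj e Y) e (Y e) = Y.
Proof. by apply/ffunP => f; rewrite !ffunE; case: eqP => [->|]. Qed.

Lemma up_closed_proj e M L : is_COM L -> up_closed M L ->
  up_closed (proj e @: M) (proj e @: L).
Proof.
move=> L_COM [sML uML]; split; first exact: imsetS.
move=> _ _ /imsetP[Y YM ->] /imsetP[X XL ->] /face_leP YX.
have YL := subsetP sML _ YM.
(* [X] may fail to lie above [Y] at [e]; [svcomp Y X] does lie above it and has the same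
   projection. *)
apply/imsetP; exists (svcomp Y X).
  apply: (uML Y) => //; first exact: COM_comp.
  by apply/face_leP => f Yf; rewrite ffunE Yf.
apply/ffunP => f; have:= YX f; rewrite !ffunE; case: (f == e) => // YXf.
by case: ifP => // /YXf.
Qed.

Lemma fibre_sum (R : pzRingType) e Z M (c : {ffun E -> sign} -> R) :
  proj e Z = Z ->
  \sum_(Y in M | proj e Y == Z) c Y
  = \sum_s (if upd Z e s \in M then c (upd Z e s) else 0).
Proof.
move=> eZ; rewrite -big_mkcond /=.
rewrite (reindex_onto (upd Z e) (fun Y => Y e)) /= => [|Y /andP[_ /eqP <-]].
  apply: eq_bigl => s; rewrite proj_upd eZ eqxx andbT ffunE eqxx eqxx.
  by rewrite andbT.
exact: upd_proj.
Qed.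

Lemma proj_id e Y : proj e (proj e Y) = proj e Y.
Proof. by apply/ffunP => f; rewrite !ffunE; case: eqP. Qed.

(* The weight is (-1)^codim; the sum is a compactly supported Euler           *)
(* characteristic. Each fibre of [proj e] is one sign or all three of them,   *)
(* so it contributes 1 or 1 - 1 + 1.                                          *)
Lemma euler_weights (R : pzRingType) L : is_COM L ->
  exists w : {ffun E -> sign} -> R, (forall Y, w Y * w Y = 1) /\
  forall M, up_closed M L -> is_COM M -> M != set0 -> \sum_(Y in M) w Y = 1.
Proof.
have [s L_s] : exists s : seq E, forall X f, X \in L -> f \notin s -> X f = Zero.
  by exists (enum E) => X f _; rewrite mem_enum.
elim: s L L_s => [|e s IHs] L L_s L_COM.
  exists (fun=> 1); split=> [_|M [sML _] _]; first by rewrite mulr1.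
  have L0 X : X \in L -> X = [ffun=> Zero].
    by move=> XL; apply/ffunP => f; rewrite ffunE (L_s X).
  case/set0Pn => Y YM; suff -> : M = [set [ffun=> Zero]] by rewrite big_set1.
  apply/setP => X; rewrite inE; apply/idP/eqP => [/(subsetP sML)/L0 //|->].
  by rewrite -(L0 Y) // (subsetP sML).
have [||w' [w'1 w'S]] := IHs (proj e @: L); last 1 first.
(* Decided in [L], so that the weight does not depend on [M]; upward closure gives the same answer
   inside [M] ([flat0]). *)
- pose flat Y := (Y e == Zero) && [exists X in L, (proj e X == proj e Y) && (X e != Zero)].
  exists (fun Y => w' (proj e Y) * (if flat Y then -1 else 1)); split=> [Y|M uML M_COM M0].
    case: (flat Y); first by rewrite mulrN1 mulrNN w'1.
    by rewrite mulr1 w'1.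
  have [sML u] := uML; have [FS SE] := M_COM.
  transitivity (\sum_(Z in proj e @: M) w' Z); last first.
    apply: w'S; [exact: up_closed_proj | exact: proj_COM |].
    by case/set0Pn: M0 => Y YM; apply/set0Pn; exists (proj e Y); exact: imset_f.
  rewrite (partition_big_imset (proj e)) /=; apply: eq_bigr => Z /imsetP[Y YM eZ].
  have pZ : proj e Z = Z by rewrite eZ proj_id.
  transitivity (w' Z * \sum_(Y in M | proj e Y == Z) (if flat Y then -1 else 1)).
    by rewrite mulr_sumr; apply: eq_bigr => X /andP[_ /eqP->].
  rewrite fibre_sum // big_sign -[RHS]mulr1; congr (_ * _).
  have updE t : upd Z e t e = t by rewrite ffunE eqxx.
  have flatN t : t != Zero -> flat (upd Z e t) = false.
    by move=> /negPf t0; rewrite /flat updE t0.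
  rewrite (flatN Plus) // (flatN Minus) // {flatN}.
  have Zle t : face_le (upd Z e Zero) (upd Z e t).
    by apply/face_leP => f; rewrite !ffunE; case: (f == e).
  have flat0 : upd Z e Zero \in M ->
      flat (upd Z e Zero) = (upd Z e Plus \in M) || (upd Z e Minus \in M).
    move=> M_0; rewrite /flat updE /=; apply/exists_inP/idP.
      case=> X XL; rewrite proj_upd pZ => /andP[/eqP XZ Xe].
      have : X \in M.
        by apply: (u _ _ M_0) => //; rewrite -(upd_proj e X) XZ.
      rewrite -(upd_proj e X) XZ; case: (X e) Xe => // _ -> //.
      by rewrite orbT.
    move=> MZ; have [t t0 Mt] : exists2 t, t != Zero & upd Z e t \in M.
      by case/orP: MZ; [exists Plus | exists Minus].
    by exists (upd Z e t); rewrite ?(subsetP sML) // !proj_upd eqxx updE.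
  have Mopp t : upd Z e Zero \in M -> upd Z e t \in M -> upd Z e (sopp t) \in M.
    move=> M_0 Mt; suff -> : upd Z e (sopp t)
        = svcomp (upd Z e Zero) (svopp (upd Z e t)) by apply: FS.
    by apply/ffunP => f; rewrite !ffunE; case: (f == e) => //; case: (Z f).
  have M0t : upd Z e Plus \in M -> upd Z e Minus \in M -> upd Z e Zero \in M.
    move=> Mp Mm; have [|X [XM Xe XZ]] := SE _ _ Mp Mm e.
      by rewrite inE !updE.
    suff -> : upd Z e Zero = X by [].
    apply/ffunP => f; rewrite ffunE; case: eqP => [->//|/eqP/negPf fe].
    by rewrite XZ ?inE !ffunE fe; case: (Z f).
  have : [|| upd Z e Zero \in M, upd Z e Plus \in M | upd Z e Minus \in M].
    by move: YM; rewrite -(upd_proj e Y) -eZ; case: (Y e) => ->; rewrite ?orbT.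
  have Mm : _ -> _ -> upd Z e Minus \in M := Mopp Plus.
  have Mp : _ -> _ -> upd Z e Plus \in M := Mopp Minus.
  case: (_ Zero \in M) Mm Mp M0t flat0 => [Mm Mp _ /(_ isT)-> // | _ _ M0t _].
    case: (_ Plus \in M) (_ Minus \in M) Mm Mp => [] [] /=.
    + by rewrite addNr add0r.
    + by move/(_ isT isT).
    + by move=> _ /(_ isT isT).
    + by rewrite !addr0.
  case: (_ Plus \in M) (_ Minus \in M) M0t => [] [] //= => [/(_ isT isT)//|_ _|_ _].
    by rewrite add0r addr0.
  by rewrite !add0r.
- move=> _ f /imsetP[X XL ->] fs; rewrite ffunE; case: eqP => // /eqP fe.
  by apply: L_s => //; rewrite inE negb_or fe.
- exact: proj_COM.
Qed.

End Covectors.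

(** * Detours through a hyperplane *)

Section Entries.

Variables (K : fieldType) (E : finType).
Implicit Types (X Y Z P Q G : {ffun E -> sign}) (L M : {set {ffun E -> sign}}).

Local Notation V := (varchenko_entry K).

Definition pair_weight (f : E) := xvar K f true * xvar K f false.

Definition nowhere_zero X := [forall e, X e != Zero].

Lemma nowhere_zeroP X : reflect (forall e, X e != Zero) (nowhere_zero X).
Proof. exact: forallP. Qed.

Lemma in_topes L X : (X \in topes L) = (X \in L) && nowhere_zero X.
Proof. by rewrite inE. Qed.

Definition local_entry (f : E) (s t : sign) :=
  if (s == sopp t) && (s != Zero) then xvar K f (s == Plus) else 1.

Lemma entryE P Q : V P Q = \prod_f local_entry f (P f) (Q f).
Proof. by rewrite /varchenko_entry big_mkcond; apply: eq_bigr => f _; rewrite inE. Qed.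

Lemma entry_diag P : V P P = 1.
Proof.
rewrite entryE big1 // => f _; rewrite /local_entry.
by case: (P f).
Qed.

(** [svcomp Y P] is the gate of [P] in the star of [Y]: it agrees with [Q] on the support of [Y] and
    with [P] elsewhere, so the separator of [P] and [Q] splits in two. *)
Lemma entry_gate P Q Y : face_le Y Q ->
  V P (svcomp Y P) * V (svcomp Y P) Q = V P Q.
Proof.
move/face_leP => YQ; rewrite !entryE -big_split /=; apply: eq_bigr => f _ /=.
rewrite ffunE; have [Y0 | /YQ->] := eqVneq (Y f) Zero.
  by rewrite /local_entry; case: (P f) => //=; rewrite mul1r.
rewrite /local_entry; case: (Y f) => //=; rewrite ?mulr1 //.
Qed.

Definition detour Q Y G :=
  V G Q * \prod_(f in zero_set Y | G f == Q f) pair_weight f.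

(** On the way through [svcomp Y P], an element separating [P] and [Q] is crossed once. Where they
    agree, it is crossed there and back if [Y f] is opposite, giving [pair_weight f]; the product in
    [detour] makes [Y f = Zero] count the same. *)
Lemma detourE P Q Y : nowhere_zero P -> nowhere_zero Q ->
  V P (svcomp Y P) * detour Q Y (svcomp Y P)
  = V P Q * \prod_(f | P f == Q f) (if Y f == Q f then 1 else pair_weight f).
Proof.
move=> /nowhere_zeroP P0 /nowhere_zeroP Q0.
rewrite /detour !entryE [X in _ * (_ * X)]big_mkcond [X in _ = _ * X]big_mkcond -!big_split /=.
apply: eq_bigr => f _ /=; rewrite !inE !ffunE.
move: (P0 f) (Q0 f); rewrite /local_entry /pair_weight.
by case: (P f) (Q f) (Y f) => [] [] [] //= _ _; rewrite ?mulr1 ?mul1r // mulrC.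
Qed.

(** Going from [G] to its opposite crosses all of [zero_set Y]; going on to [Q] crosses back those
    elements where [G] and [Q] agree. *)
Lemma detour_minimal Q Y G : nowhere_zero G -> nowhere_zero Q ->
  face_le Y G -> face_le Y Q ->
  detour Q Y G = V G (svcomp Y (svopp G)) * V (svcomp Y (svopp G)) Q.
Proof.
move=> /nowhere_zeroP G0 /nowhere_zeroP Q0 /face_leP YG /face_leP YQ.
rewrite /detour !entryE [X in _ * X]big_mkcond -!big_split /=.
apply: eq_bigr => f _ /=; rewrite !inE !ffunE.
move: (G0 f) (Q0 f) (YG f) (YQ f); rewrite /local_entry /pair_weight.
by case: (G f) (Q f) (Y f) => [] [] [] //= _ _;
  do ?[move=> /(_ isT) // | move=> _]; rewrite ?mulr1 ?mul1r // mulrC.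
Qed.

Lemma opposite_weight Y G : nowhere_zero G -> face_le Y G ->
  V G (svcomp Y (svopp G)) * V (svcomp Y (svopp G)) G = face_weight K Y.
Proof.
move=> /nowhere_zeroP G0 /face_leP YG.
rewrite /face_weight !entryE [RHS]big_mkcond -!big_split /=.
apply: eq_bigr => f _ /=; rewrite !inE !ffunE.
move: (G0 f) (YG f); rewrite /local_entry.
by case: (G f) (Y f) => [] [] //= _;
  do ?[move=> /(_ isT) // | move=> _]; rewrite ?mulr1 ?mul1r // mulrC.
Qed.

Section Euler.

Variables (L : {set {ffun E -> sign}}) (w : {ffun E -> sign} -> {mpoly K[#|{: E * bool}|]}).
Hypothesis w_sum : forall M, up_closed M L -> is_COM M -> M != set0 -> \sum_(Y in M) w Y = 1.

(* Each factor is [a_f + (1 - a_f) * (Y f == Q f)], so the sum is a convex    *)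
(* combination of the Euler sums over the subcomplexes fixing signs of Q.     *)
Lemma euler_interpolate M Q (s : seq E) : up_closed M L -> is_COM M -> nowhere_zero Q ->
  (exists2 Y, Y \in M & {in s, Y =1 Q}) ->
  \sum_(Y in M) w Y * \prod_(f <- s) (if Y f == Q f then 1 else pair_weight f) = 1.
Proof.
move=> uM M_COM /nowhere_zeroP Q0; elim: s M uM M_COM => [|f s IHs] M uM M_COM [Y YM YQ].
  rewrite -[RHS](w_sum uM) //; last by apply/set0Pn; exists Y.
  by apply: eq_bigr => X _; rewrite big_nil mulr1.
have ->: \sum_(X in M) w X * \prod_(g <- f :: s) (if X g == Q g then 1 else pair_weight g)
  = pair_weight f * (\sum_(X in M) w X * \prod_(g <- s) (if X g == Q g then 1 else pair_weight g))
  + (1 - pair_weight f) * (\sum_(X in halfspace f (Q f) M)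
       w X * \prod_(g <- s) (if X g == Q g then 1 else pair_weight g)).
  rewrite !mulr_sumr.
  rewrite [X in _ + X](eq_bigl (fun X => (X \in M) && (X f == Q f))) => [|X]; last by rewrite inE.
  rewrite [X in _ + X]big_mkcondr /= -big_split; apply: eq_bigr => X _.
  by rewrite /= big_cons; case: ifP => _; ring.
have YQs: {in s, Y =1 Q} by move=> g gs; apply: YQ; rewrite inE gs orbT.
rewrite IHs //; last by exists Y.
rewrite IHs.
- by rewrite !mulr1 addrC subrK.
- by apply: up_closed_trans uM; apply: halfspace_up_closed.
- exact: halfspace_COM.
- by exists Y => //; rewrite inE YM YQ ?mem_head /=.
Qed.

End Euler.

(** Eliminating [e] between [P] and [Q] gives a covector that vanishes at [e] and agrees with both
    wherever they agree: the witness required by [euler_interpolate]. *)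
Lemma tope_detour L w e P Q : is_COM L ->
  (forall M, up_closed M (halfspace e Zero L) -> is_COM M -> M != set0 ->
     \sum_(Y in M) w Y = 1) ->
  P \in topes L -> Q \in topes L -> P e != Q e ->
  V P Q = \sum_(Y in halfspace e Zero L) w Y * (V P (svcomp Y P) * detour Q Y (svcomp Y P)).
Proof.
move=> L_COM w_sum; rewrite !in_topes => /andP[PL P0] /andP[QL Q0] PQe.
have [_ SE] := L_COM.
have sepE f : (f \in separator P Q) = (P f != Q f).
  rewrite inE; move/nowhere_zeroP/(_ f): P0; move/nowhere_zeroP/(_ f): Q0.
  by case: (P f) (Q f) => [] [].
have [|Z [ZL Ze ZPQ]] := SE P Q PL QL e; first by rewrite sepE.
under eq_bigr => Y _ do rewrite detourE // mulrCA -big_enum.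
rewrite -mulr_sumr (euler_interpolate w_sum) ?mulr1 //.
  exact: halfspace_COM.
exists Z; first by rewrite inE ZL Ze.
move=> f; rewrite mem_enum => fPQ; have PQf : P f = Q f by exact/eqP.
rewrite ZPQ ?sepE ?PQf ?eqxx // ffunE PQf.
by rewrite (nowhere_zeroP _ Q0).
Qed.

End Entries.

(** * The localized column space *)

Section Span.

Variables (K : fieldType) (E : finType).

Local Notation SV := {ffun E -> sign}.
Local Notation R := {mpoly K[#|{: E * bool}|]}.
Local Notation U := {ffun SV -> R}.
Local Notation V := (varchenko_entry K).

Implicit Types (X Y Z P Q G : SV) (L : {set SV}) (phi psi : U) (M : U -> Prop).

Definition scale (c : R) phi : U := [ffun P => c * phi P].

Definition delta P : U := [ffun Q => (Q == P)%:R].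

Definition column L Q : U := [ffun P => if P \in topes L then V P Q else 0].

(* The trace on [U] of a submodule of the localization of [U] at the factors  *)
(* [1 - a(Y)].                                                                *)
Definition local_submodule L M : Prop :=
  [/\ M 0, forall phi psi, M phi -> M psi -> M (phi + psi),
      forall c phi, M phi -> M (scale c phi)
    & forall Y phi, Y \in L -> zero_set Y != set0 ->
        M (scale (1 - face_weight K Y) phi) -> M phi].

Lemma local_submodule_sub L L' M : L' \subset L ->
  local_submodule L M -> local_submodule L' M.
Proof.
move=> sL'L [M0 MD MZ MV]; split=> // Y phi YL'; apply: MV.
exact: (subsetP sL'L).
Qed.

(** Lets the induction hypothesis for a smaller COM be applied to the preimage of [M] under [extend]
    or [add_opposite]. *)
Lemma local_submodule_preim L M (h : U -> U) :
  (forall phi psi, h (phi + psi) = h phi + h psi) ->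
  (forall c phi, h (scale c phi) = scale c (h phi)) ->
  local_submodule L M -> local_submodule L (fun phi => M (h phi)).
Proof.
move=> hD hZ [M0 MD MZ MV]; split=> [||c phi|Y phi YL Y0].
- suff -> : h 0 = 0 by [].
  have scale0 phi : scale 0 phi = 0 by apply/ffunP => P; rewrite !ffunE mul0r.
  by rewrite -(scale0 0) hZ scale0.
- by move=> phi psi; rewrite hD; apply: MD.
- by rewrite hZ; apply: MZ.
- by rewrite hZ; apply: MV.
Qed.

Lemma local_submodule_sum L M (I : finType) (A : {pred I}) (F : I -> U) :
  local_submodule L M -> (forall i, i \in A -> M (F i)) -> M (\sum_(i in A) F i).
Proof. by move=> [M0 MD _ _] MF; apply: big_ind. Qed.

Lemma scale1 phi : scale 1 phi = phi.
Proof. by apply/ffunP => P; rewrite ffunE mul1r. Qed.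

Lemma scaleB L M c phi psi : local_submodule L M -> M phi -> M psi -> M (phi - scale c psi).
Proof.
move=> [_ MD MZ _] Mphi Mpsi.
suff -> : phi - scale c psi = phi + scale (- c) psi by apply: MD => //; apply: MZ.
by apply/ffunP => P; rewrite !ffunE mulNr.
Qed.

Lemma local_submodule_support L M (S : {set SV}) phi : local_submodule L M ->
  (forall G, G \in S -> M (delta G)) -> (forall P, P \notin S -> phi P = 0) -> M phi.
Proof.
move=> LM MS phi0; have [_ _ MZ _] := LM.
suff -> : phi = \sum_(G in S) scale (phi G) (delta G).
  by apply: (local_submodule_sum LM) => G GS; apply/MZ/MS.
apply/ffunP => P; rewrite sum_ffunE.
under eq_bigr => G _ do rewrite !ffunE mulr_natr mulrb.
rewrite -big_mkcondr /=; have [PS|PS] := boolP (P \in S).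
  rewrite (big_pred1 P) // => G; rewrite /= [LHS]andbC eq_sym.
  by case: eqP => [->|_]; rewrite ?PS.
rewrite phi0 // big1 // => G /andP[GS /eqP PG].
by rewrite PG GS in PS.
Qed.

(** Transfers functions from the topes above [Y] to those of [L]; by [entry_gate], columns of the
    star become columns of [L]. *)
Definition extend L Y phi : U :=
  [ffun P => if P \in topes L then V P (svcomp Y P) * phi (svcomp Y P) else 0].

Lemma extend_submodule L Y M :
  local_submodule L M -> local_submodule (star Y L) (fun phi => M (extend L Y phi)).
Proof.
move=> LM; apply: (@local_submodule_preim _ _ (extend L Y)).
- by move=> phi psi; apply/ffunP => P; rewrite !ffunE; case: ifP; rewrite ?mulrDr ?addr0.
- by move=> c phi; apply/ffunP => P; rewrite !ffunE; case: ifP; rewrite ?mulr0 // mulrCA.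
- by apply: local_submodule_sub LM; apply/subsetP => X /setIdP[].
Qed.

Lemma comp_tope L Y P : is_COM L -> Y \in L -> P \in topes L ->
  svcomp Y P \in topes (star Y L).
Proof.
move=> L_COM YL; rewrite !in_topes inE => /andP[PL /nowhere_zeroP P0].
rewrite COM_comp //=; apply/andP; split.
  by apply/face_leP => f Yf; rewrite ffunE Yf.
by apply/nowhere_zeroP => f; rewrite ffunE; case: ifP.
Qed.

Lemma extend_column L Y Q : is_COM L -> Y \in L -> face_le Y Q ->
  extend L Y (column (star Y L) Q) = column L Q.
Proof.
move=> L_COM YL YQ; apply/ffunP => P; rewrite !ffunE; case: ifP => // PT.
by rewrite comp_tope // entry_gate.
Qed.

(** Made for [Y] below all of [L] with [Y e = Zero]: the half of column [Q] on the side [s = Q e]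
    becomes that half plus [c] times the detours through [Y] from the other side. *)
Definition add_opposite L e s c Y phi : U :=
  [ffun G => phi G + (if (G \in topes L) && (G e != s) then
     c * (V G (svcomp Y (svopp G)) * phi (svcomp Y (svopp G))) else 0)].

Lemma add_opposite_submodule L e s c Y M :
  local_submodule L M -> local_submodule L (fun phi => M (add_opposite L e s c Y phi)).
Proof.
apply: local_submodule_preim => [phi psi | d phi].
  apply/ffunP => P; rewrite !ffunE; case: ifP => _; last by rewrite !addr0.
  by rewrite !mulrDr addrACA.
apply/ffunP => P; rewrite !ffunE; case: ifP => _; last by rewrite !addr0.
by ring.
Qed.

Lemma opposite_tope L Y G : is_COM L -> Y \in L -> star Y L = L -> G \in topes L ->
  svcomp Y (svopp G) \in topes L.
Proof.
move=> [FS _] YL YLL; rewrite !in_topes => /andP[GL /nowhere_zeroP G0].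
rewrite FS //=; apply/nowhere_zeroP => f; rewrite !ffunE; case: ifP => // _.
by case: (G f) (G0 f).
Qed.

Lemma oppositeK Y G : face_le Y G -> svcomp Y (svopp (svcomp Y (svopp G))) = G.
Proof.
move/face_leP => YG; apply/ffunP => f; rewrite !ffunE; case: ifP => [/YG->//|Yf].
by rewrite Yf soppK.
Qed.

(* Induction on #|L|. The stars of the Y with Y e = 0 and the two halfspaces   *)
(* at e are smaller COMs; by [tope_detour] the half of a column on the other   *)
(* side of e is generated by the stars, so the columns of both halfspaces are  *)
(* available. If some star is all of L, its term is missing and one only gets  *)
(* [delta P +- V (- P) P * delta (- P)]; combining the relations for P and -P  *)
(* costs a division by 1 - a(Y0).                                             *)
Lemma columns_generate L M : is_COM L -> local_submodule L M ->
  (forall Q, Q \in topes L -> M (column L Q)) ->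
  forall P, P \in topes L -> M (delta P).
Proof.
have [n] := ubnP #|L|; elim: n => // n IHn in L M *.
rewrite ltnS => leLn L_COM LM Mcol P0 P0T.
have IH L' M' : L' \proper L -> is_COM L' -> local_submodule L' M' ->
    (forall Q, Q \in topes L' -> M' (column L' Q)) ->
    forall P, P \in topes L' -> M' (delta P).
  by move=> /proper_card ltL'L; apply: IHn; apply: leq_trans leLn.
have [M_0 MD MZ MV] := LM.
have [|] := boolP [forall P in topes L, P == P0].
  move=> /forall_inP eqP0; suff -> : delta P0 = column L P0 by apply: Mcol.
  apply/ffunP => P; rewrite !ffunE; case: ifPn => [/eqP0/eqP->|].
    by rewrite eqxx entry_diag.
  by case: eqP => // ->; rewrite P0T.
case/forall_inPn => P1 P1T P10.
have [e P01e] : exists e, P0 e != P1 e.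
  apply/existsP; rewrite -negb_forall; apply: contra P10 => /forallP P01.
  by apply/eqP/ffunP => e; rewrite (eqP (P01 e)).
have tope0 P f : P \in topes L -> P f != Zero.
  by rewrite in_topes => /andP[_ /nowhere_zeroP].
have topeL P : P \in topes L -> P \in L by rewrite in_topes => /andP[].
have half_proper s : halfspace e s L \proper L.
  apply/properP; split; first by apply/subsetP => X /setIdP[].
  have [P0s | P0s] := eqVneq (P0 e) s; [exists P1 | exists P0]; rewrite ?topeL //.
    by rewrite inE -P0s [P1 e == _]eq_sym (negPf P01e) andbF.
  by rewrite inE (negPf P0s) andbF.
have half_topes s P : P \in topes (halfspace e s L) = (P \in topes L) && (P e == s).
  by rewrite !in_topes inE -!andbA; congr (_ && _); rewrite andbC.
have [w [w1 w_sum]] := euler_weights R (halfspace_COM e Zero L_COM).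
pose t Y Q : U := [ffun P =>
  if (P \in topes L) && (P e != Q e) then V P (svcomp Y P) * detour K Q Y (svcomp Y P) else 0].
have Mt Y Q : Y \in halfspace e Zero L -> star Y L \proper L -> M (t Y Q).
  rewrite inE => /andP[YL /eqP Ye] sYL.
  (* All functions on the topes above [Y] thus extend into [M]. As [Y e = Zero], [P] and
     [svcomp Y P] are on the same side of [e], so [t Y Q] is such an extension. *)
  have MY := IH _ _ sYL (star_COM Y L_COM) (extend_submodule Y LM).
  pose phi : U := [ffun G => if (G \in topes (star Y L)) && (G e != Q e) then detour K Q Y G else 0].
  have -> : t Y Q = extend L Y phi.
    apply/ffunP => P; rewrite !ffunE; case: (boolP (P \in topes L)) => //= PT.
    by rewrite comp_tope //= Ye eqxx /=; case: ifP; rewrite ?mulr0.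
  apply: (local_submodule_support (extend_submodule Y LM) (S := topes (star Y L))) => [|P PnT].
    apply: MY => G; rewrite in_topes inE -andbA => /and3P[GL YG G0].
    by rewrite extend_column //; apply: Mcol; rewrite in_topes GL.
  by rewrite ffunE (negPf PnT).
have column_split Q : Q \in topes L ->
    column L Q = column (halfspace e (Q e) L) Q + \sum_(Y in halfspace e Zero L) scale (w Y) (t Y Q).
  move=> QT; apply/ffunP => P; rewrite !ffunE sum_ffunE half_topes.
  have [PT | PT] /= := boolP (P \in topes L); last first.
    by rewrite big1 ?addr0 // => Y _; rewrite !ffunE (negPf PT) mulr0.
  have [PQe | PQe] := eqVneq (P e) (Q e).
    by rewrite big1 ?addr0 // => Y _; rewrite !ffunE PQe eqxx andbF mulr0.
  rewrite add0r (tope_detour L_COM w_sum PT QT PQe).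
  by apply: eq_bigr => Y _; rewrite !ffunE PT PQe.
have Mtail Q : Q \in topes L -> M (column (halfspace e (Q e) L) Q
    + \sum_(Y in halfspace e Zero L | star Y L == L) scale (w Y) (t Y Q)).
  move=> QT; set phi := (X in M X).
  suff -> : phi = column L Q - scale 1
      (\sum_(Y in halfspace e Zero L | star Y L != L) scale (w Y) (t Y Q)).
    apply: (scaleB _ LM); first exact: Mcol.
    apply: (local_submodule_sum LM) => Y /andP[Y0 YL]; apply/MZ/Mt => //.
    by rewrite properEneq YL; apply/subsetP => X /setIdP[].
  rewrite /phi column_split // [in RHS](bigID (fun Y => star Y L == L)) /=.
  by rewrite scale1 addrA addrK.
have [/exists_inP[Y0] | /exists_inPn noY0] := boolP [exists Y in halfspace e Zero L, star Y L == L].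
  (* [Y0] lies below every covector, so taking opposites over [Y0] preserves topes and swaps the
     sides of [e]. *)
  move=> Y0L0 /eqP Y0L; have /setIdP[Y0L' /eqP Y0e] := Y0L0.
  have Y0le P : P \in L -> face_le Y0 P by rewrite -{1}Y0L => /setIdP[].
  pose opp G := svcomp Y0 (svopp G).
  have oppT G : G \in topes L -> opp G \in topes L by apply: opposite_tope.
  have oppe G : opp G e = sopp (G e) by rewrite !ffunE Y0e eqxx.
  have oppeE G Q : G \in topes L -> Q \in topes L -> (opp G e == Q e) = (G e != Q e).
    move=> GT QT; move: (tope0 G e GT) (tope0 Q e QT).
    by rewrite oppe; case: (G e) (Q e) => [] [].
  have oppK G : G \in topes L -> opp (opp G) = G by move=> /topeL/Y0le/oppositeK.
  have Y0tail Q : \sum_(Y in halfspace e Zero L | star Y L == L) scale (w Y) (t Y Q)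
      = scale (w Y0) (t Y0 Q).
    apply: big_pred1 => Y; apply/andP/eqP => [[/setIdP[YL _] /eqP YLL]|->]; last by rewrite Y0L.
    have /face_leP YY0 : face_le Y Y0 by move: Y0L'; rewrite -{1}YLL => /setIdP[].
    have /face_leP Y0Y := Y0le _ YL.
    apply/ffunP => f; have [Yf|/YY0->//] := eqVneq (Y f) Zero.
    by have [->//|/Y0Y->] := eqVneq (Y0 f) Zero.
  have Mpair P : P \in topes L -> M (delta P + scale (w Y0 * V (opp P) P) (delta (opp P))).
    move=> PT.
    (* Induction on the half containing [P], for the preimage of [M] under [add_opposite]; its
       hypothesis on columns is [Mtail]. *)
    have : M (add_opposite L e (P e) (w Y0) Y0 (delta P)).
      apply: (IH (halfspace e (P e) L)
        (fun phi => M (add_opposite L e (P e) (w Y0) Y0 phi))) => //.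
      - exact: halfspace_COM.
      - apply: local_submodule_sub (proper_sub (half_proper (P e))) _.
        exact: add_opposite_submodule.
      - move=> Q; rewrite half_topes => /andP[QT /eqP QPe].
        rewrite -QPe; have := Mtail Q QT; rewrite Y0tail; congr M.
        apply/ffunP => G; rewrite !ffunE; congr (_ + _).
        case: (boolP (G \in topes L)) => GT /=; last by rewrite mulr0.
        case: ifPn => GQe; last by rewrite mulr0.
        rewrite half_topes oppT // oppeE // GQe /=.
        rewrite (eqP (Y0le G (topeL G GT))) entry_diag mul1r.
        move: (GT) (QT); rewrite !in_topes => /andP[GL G0] /andP[QL Q0].
        by rewrite detour_minimal ?Y0le.
      - by rewrite half_topes PT eqxx.
    congr M; apply/ffunP => G; rewrite !ffunE; congr (_ + _).
    have [-> | GP] := eqVneq G (opp P).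
      by rewrite oppT //= -oppeE ?oppT // -/(opp _) oppK // !eqxx mulrA.
    case: ifP => [/andP[GT _]|_]; last by rewrite mulr0.
    case: eqP => [PG|_]; last by rewrite !mulr0.
    by rewrite -PG oppK ?eqxx in GP.
  apply: (MV Y0) => //; first by apply/set0Pn; exists e; rewrite inE Y0e.
  (* Subtracting this multiple of the relation for [opp P0] cancels [delta (opp P0)] and, since
     [w Y0] squares to 1, leaves (1 - a(Y0)) [delta P0]. *)
  have := scaleB (w Y0 * V (opp P0) P0) LM (Mpair _ P0T) (Mpair _ (oppT _ P0T)).
  congr M; apply/ffunP => G; rewrite oppK // !ffunE.
  rewrite -(@opposite_weight _ _ Y0 P0).
  - rewrite -/(opp P0) mulrDr opprD addrA addrK mulrA mulrACA w1 mul1r mulrBl mul1r.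
    by rewrite [V P0 _ * V _ P0]mulrC.
  - by move: P0T; rewrite in_topes => /andP[].
  - exact/Y0le/topeL.
have Mhalf Q : Q \in topes L -> M (column (halfspace e (Q e) L) Q).
  move/Mtail; rewrite big_pred0 ?addr0 // => Y.
  by apply/negP => /andP[/noY0/negP].
apply: (IH (halfspace e (P0 e) L)) => //.
- exact: halfspace_COM.
- exact: local_submodule_sub (proper_sub (half_proper _)) LM.
- by move=> Q; rewrite half_topes => /andP[QT /eqP <-]; apply: Mhalf.
- by rewrite half_topes P0T eqxx.
Qed.

End Span.

(** * Prime factors *)

Section PrimeElements.

Variable R : idomainType.

Definition divides (p a : R) : Prop := exists c, a = p * c.

Definition prime_element (p : R) : Prop :=
  p != 0 /\ forall a b, divides p (a * b) -> divides p a \/ divides p b.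

(** Each prime in turn divides [d] or the cofactor [w] and is cancelled there. *)
Lemma divisor_of_prime_product (I : eqType) (p : I -> R) (l : seq I) (d w : R) :
  {in l, forall i, prime_element (p i)} -> d * w = \prod_(i <- l) p i ->
  exists l' u, [/\ {subset l' <= l}, u \is a GRing.unit
                 & d = u * \prod_(i <- l') p i].
Proof.
elim: l d w => [|i l IHl] d w p_prime.
  rewrite big_nil => dw; exists [::], d; rewrite big_nil mulr1; split=> //.
  by apply/unitrPr; exists w.
rewrite big_cons => dw; have [pi0 pi_prime] := p_prime i (mem_head _ _).
have pl_prime : {in l, forall j, prime_element (p j)}.
  by move=> j jl; apply: p_prime; rewrite inE jl orbT.
have [|[c dc]|[c wc]] := pi_prime d w; first by exists (\prod_(j <- l) p j).
  have [|l' [u [l'l u_unit cE]]] := IHl c w pl_prime.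
    by apply: (mulfI pi0); rewrite mulrA -dc.
  exists (i :: l'), u; split=> //; last by rewrite dc cE big_cons mulrCA.
  by move=> j; rewrite !inE => /orP[->//|/l'l->]; rewrite orbT.
have [|l' [u [l'l u_unit du]]] := IHl d c pl_prime.
  by apply: (mulfI pi0); rewrite mulrCA -wc.
by exists l', u; split=> // j /l'l; rewrite inE => ->; rewrite orbT.
Qed.

End PrimeElements.

Lemma mpoly_ring_ind (K : fieldType) n (P : {mpoly K[n]} -> Prop) :
  (forall c, P c%:MP) -> (forall i, P 'X_i) ->
  (forall p q, P p -> P q -> P (p + q)) -> (forall p q, P p -> P q -> P (p * q)) ->
  forall p, P p.
Proof.
move=> PC PX PD PM p; rewrite (mpolyE p).
apply: big_ind => [|//|m _]; first by rewrite -mpolyC0.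
rewrite -mul_mpolyC; apply: (PM) => //.
rewrite mpolyXE_id; apply: big_ind => [||i _]; [by rewrite -mpolyC1 | exact: PM |].
by elim: (m i) => [|k IHk]; [rewrite expr0 -mpolyC1 | rewrite exprS; apply: PM].
Qed.

Section PrimeBinomial.

Variables (K : fieldType) (n : nat) (i : 'I_n) (m : {mpoly K[n]}).

Local Notation "x %:F" := (@FracField.tofrac {mpoly K[n]} x).

(** Substitutes 0 for ['X_i]; [kill_var m = m] thus says that ['X_i] does not occur in [m]. *)
Definition kill_var : {mpoly K[n]} -> {mpoly K[n]} :=
  mmap (@mpolyC n K) (fun j => if j == i then 0 else 'X_j).

Hypothesis m_neq0 : m != 0.
Hypothesis m_free : kill_var m = m.

Let p := 1 - 'X_i * m.

(* Its kernel is generated by p, which makes p prime. *)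
Let theta : {mpoly K[n]} -> {fraction {mpoly K[n]}} :=
  mmap (@FracField.tofrac {mpoly K[n]} \o @mpolyC n K)
       (fun j => if j == i then (m%:F)^-1 else ('X_j)%:F).

Let kill_varX j : kill_var 'X_j = if j == i then 0 else 'X_j.
Proof. by rewrite /kill_var mmapX mmap1U. Qed.

Let theta_kill_var f : theta (kill_var f) = (kill_var f)%:F.
Proof.
elim/mpoly_ring_ind: f => [c|j|f g IHf IHg|f g IHf IHg].
- by rewrite /kill_var /theta !mmapC.
- rewrite kill_varX; case: eqP => [_|/eqP ji]; first by rewrite /theta rmorph0 tofrac0.
  by rewrite /theta mmapX mmap1U (negPf ji).
- by rewrite /kill_var /theta !rmorphD; congr (_ + _).
- by rewrite /kill_var /theta !rmorphM; congr (_ * _).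
Qed.

Let theta_p : theta p = 0.
Proof.
rewrite /p /theta rmorphB rmorph1 rmorphM /= -/theta -{1}m_free theta_kill_var m_free.
by rewrite /theta mmapX mmap1U eqxx mulVf ?subrr // tofrac_eq0.
Qed.

(* Modulo p, [m] inverts ['X_i], so a power of [m] clears ['X_i].              *)
Let clear_var f : exists k r c, m ^+ k * f = kill_var r + p * c.
Proof.
elim/mpoly_ring_ind: f => [c|j|f g|f g].
- by exists 0%N, c%:MP, 0; rewrite /kill_var mmapC mul1r mulr0 addr0.
- have [->|ji] := eqVneq j i.
    exists 1%N, 1, (- 1); rewrite /kill_var rmorph1 /p.
    by rewrite mulrN1 opprB addrC subrK mulrC.
  by exists 0%N, 'X_j, 0; rewrite kill_varX (negPf ji) mul1r mulr0 addr0.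
- move=> [k [r [c fE]]] [l [s [d gE]]].
  exists (k + l)%N, (m ^+ l * r + m ^+ k * s), (m ^+ l * c + m ^+ k * d).
  have -> : kill_var (m ^+ l * r + m ^+ k * s) = m ^+ l * kill_var r + m ^+ k * kill_var s.
    by rewrite /kill_var !(rmorphD, rmorphM, rmorphXn) /= -/kill_var m_free.
  transitivity (m ^+ l * (m ^+ k * f) + m ^+ k * (m ^+ l * g)); first by rewrite exprD; ring.
  by rewrite fE gE; ring.
- move=> [k [r [c fE]]] [l [s [d gE]]].
  exists (k + l)%N, (r * s), (kill_var r * d + c * kill_var s + p * c * d).
  rewrite /kill_var rmorphM /= -/kill_var.
  transitivity ((m ^+ k * f) * (m ^+ l * g)); first by rewrite exprD; ring.
  by rewrite fE gE; ring.
Qed.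

(** As [theta] is injective on polynomials free of ['X_i], [clear_var] leaves [m ^+ k * f] divisible
    by [p]; since ['X_i * m] is 1 modulo [p], multiplying by ['X_i ^+ k] recovers [f]. *)
Let theta_kernel f : theta f = 0 -> divides p f.
Proof.
move=> f0; have [k [r [c fE]]] := clear_var f.
have r0 : kill_var r = 0.
  apply/eqP; rewrite -tofrac_eq0 -theta_kill_var.
  have -> : kill_var r = m ^+ k * f - p * c by rewrite fE addrK.
  by rewrite /theta rmorphB !rmorphM /= -/theta f0 theta_p mulr0 mul0r subrr.
rewrite r0 add0r in fE.
have [d dE] : exists d, 1 - ('X_i * m) ^+ k = p * d.
  by exists (\sum_(j < k) ('X_i * m) ^+ j); rewrite -opprB subrX1 -mulNr opprB.
exists (f * d + 'X_i ^+ k * c).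
transitivity ((1 - ('X_i * m) ^+ k) * f + 'X_i ^+ k * (m ^+ k * f)).
  by rewrite exprMn; ring.
by rewrite dE fE; ring.
Qed.

Lemma one_sub_var_mul_prime : prime_element (1 - 'X_i * m).
Proof.
split.
  have kp : kill_var (1 - 'X_i * m) = 1.
    by rewrite /kill_var rmorphB rmorphM rmorph1 /= mmapX mmap1U eqxx mul0r subr0.
  by apply/eqP => p0; move/eqP: kp; rewrite p0 /kill_var rmorph0 eq_sym oner_eq0.
move=> a b [c abE].
have : theta a * theta b == 0.
  by rewrite /theta -rmorphM abE rmorphM /= -/theta -/p theta_p mul0r.
by rewrite mulf_eq0 => /orP[] /eqP /theta_kernel; [left | right].
Qed.

End PrimeBinomial.

Lemma prod_seq_count (R : comPzRingType) (I : finType) (A : {set I}) (F : I -> R) (l : seq I) :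
  {subset l <= A} -> \prod_(i <- l) F i = \prod_(i in A) F i ^+ count_mem i l.
Proof.
elim: l => [|j l IHl] lA; first by rewrite big_nil big1.
have jA : j \in A by apply: lA; rewrite mem_head.
rewrite big_cons IHl => [|i il]; last by apply: lA; rewrite inE il orbT.
under [RHS]eq_bigr do rewrite /= exprD.
rewrite big_split [X in _ = X * _](bigD1 j jA) /= eqxx expr1 [X in _ * X * _]big1 ?mulr1 // => i /andP[_ ij].
by rewrite eq_sym (negPf ij).
Qed.

(** * The determinant *)

Section Determinant.

Variables (K : fieldType) (E : finType).
Implicit Types (Y P Q : {ffun E -> sign}) (L : {set {ffun E -> sign}}).

Local Notation V := (varchenko_entry K).
Local Notation at0 := (meval (fun _ => 0)).

(** a(Y) is squarefree: for [f] in [zero_set Y] it is the variable of f^+ times a monomial free of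
    that variable. *)
Lemma face_factor_prime Y : zero_set Y != set0 -> prime_element (1 - face_weight K Y).
Proof.
case/set0Pn => f fY; rewrite /face_weight (bigD1 f fY) /= -mulrA.
have X0 (g : E) b : xvar K g b != 0 by rewrite -msupp_eq0 msuppX.
apply: one_sub_var_mul_prime.
  apply: mulf_neq0; first exact: X0.
  apply/prodf_neq0 => g _.
  exact: mulf_neq0.
have kX g b : (g, b) != (f, true) ->
    kill_var (enum_rank (f, true)) (xvar K g b) = xvar K g b.
  by move=> gf; rewrite /kill_var mmapX mmap1U (inj_eq enum_rank_inj) (negPf gf).
rewrite /kill_var rmorphM rmorph_prod /=; congr (_ * _).
  by apply: kX; rewrite xpair_eqE andbF.
apply: eq_bigr => g /andP[_ gf]; rewrite rmorphM /=.
by congr (_ * _); apply: kX; rewrite xpair_eqE (negPf gf).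
Qed.

Lemma at0_face_factor Y : zero_set Y != set0 -> at0 (1 - face_weight K Y) = 1.
Proof.
case/set0Pn => f fY; rewrite /face_weight (bigD1 f fY) /= rmorphB rmorph1 !rmorphM /=.
by rewrite mevalXU !mul0r subr0.
Qed.

Lemma at0_entry P Q : nowhere_zero P -> nowhere_zero Q -> at0 (V P Q) = (P == Q)%:R.
Proof.
move=> /nowhere_zeroP P0 /nowhere_zeroP Q0.
case: eqVneq => [->|PQ]; first by rewrite entry_diag rmorph1.
have [f PQf] : exists f, P f != Q f.
  apply/existsP; rewrite -negb_forall; apply: contra PQ => /forallP eqPQ.
  by apply/eqP/ffunP => f; rewrite (eqP (eqPQ f)).
have fPQ : f \in separator P Q.
  by rewrite inE; move: (P0 f) (Q0 f) PQf; case: (P f) (Q f) => [] [].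
by rewrite /varchenko_entry (bigD1 f fPQ) /= rmorphM /= mevalXU mul0r.
Qed.

(** The localized column space itself, with the denominators recorded as a list [l] of covectors
    that are not topes. *)
Lemma local_submodule_columns L : local_submodule L (fun phi =>
  exists l : seq {ffun E -> sign}, {subset l <= [set Y in L | zero_set Y != set0]} /\
  exists k, forall P, P \in topes L ->
    (\prod_(Y <- l) (1 - face_weight K Y)) * phi P = \sum_(Q in topes L) V P Q * k Q).
Proof.
split=> [|phi psi|c phi|Y phi YL Y0].
- exists [::]; split=> //; exists (fun=> 0) => P _.
  by rewrite ffunE mulr0 big1 // => Q _; rewrite mulr0.
- move=> [l [lL [k kP]]] [l' [lL' [k' kP']]]; exists (l ++ l'); split.
    by move=> Y; rewrite mem_cat => /orP[/lL|/lL'].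
  pose d := \prod_(Y <- l) (1 - face_weight K Y).
  pose d' := \prod_(Y <- l') (1 - face_weight K Y).
  exists (fun Q => d' * k Q + d * k' Q) => P PT; rewrite big_cat /= -/d -/d' ffunE.
  transitivity (d' * (d * phi P) + d * (d' * psi P)); first by ring.
  rewrite kP // kP' // !mulr_sumr -big_split; apply: eq_bigr => Q _ /=.
  by ring.
- move=> [l [lL [k kP]]]; exists l; split=> //; exists (fun Q => c * k Q) => P PT.
  by rewrite ffunE mulrCA kP // mulr_sumr; apply: eq_bigr => Q _; rewrite mulrCA.
- move=> [l [lL [k kP]]]; exists (Y :: l); split.
    by move=> Z; rewrite inE => /orP[/eqP->|/lL//]; rewrite inE YL.
  by exists k => P PT; rewrite -kP // big_cons ffunE mulrA [_ * \prod_(_ <- _) _]mulrC.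
Qed.

End Determinant.

Theorem theorem2p8 (K : fieldType) (E : finType) (L : {set {ffun E -> sign}})
    (L_COM : is_COM L) (L_simple : COM_simple L)
    (s : seq {ffun E -> sign}) (s_uniq : uniq s) (s_topes : s =i topes L) :
  exists b : {ffun E -> sign} -> nat,
    \det (varchenko K s) = \prod_(Y in L) (1 - face_weight K Y) ^+ b Y.
Proof.
have sT i : tnth (in_tuple s) i \in topes L by rewrite -s_topes mem_tnth.
have s_inj : injective (tnth (in_tuple s)) by apply/tuple_uniqP.
have sum_topes (F : {ffun E -> sign} -> {mpoly K[#|{: E * bool}|]}) :
    \sum_(Q in topes L) F Q = \sum_i F (tnth (in_tuple s) i).
  rewrite -(big_tnth _ _ s xpredT F) -big_enum /=; apply: perm_big.
  by apply: uniq_perm; rewrite ?enum_uniq // => P; rewrite mem_enum s_topes.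
have [|l lP] := fin_all_exists (fun i => columns_generate L_COM
    (local_submodule_columns K L) _ (sT i)).
  move=> Q QT; exists [::]; split=> //; exists (fun P => (P == Q)%:R) => P PT.
  rewrite big_nil mul1r ffunE PT (bigD1 Q QT) /= eqxx mulr1 big1 ?addr0 //.
  by move=> Z /andP[_ /negPf->]; rewrite mulr0.
have [k kP] := fin_all_exists (fun i => (lP i).2).
(* Inverse of the Varchenko matrix up to denominators; column [j] is cleared by its own list
   [l j]. *)
pose W := \matrix_(i, j) k j (tnth (in_tuple s) i).
have VW : varchenko K s *m W
    = diag_mx (\row_j \prod_(Y <- l j) (1 - face_weight K Y)).
  apply/matrixP => i j; rewrite !mxE.
  transitivity (\sum_(Q in topes L) varchenko_entry K (tnth (in_tuple s) i) Q * k j Q).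
    by rewrite sum_topes; apply: eq_bigr => h _; rewrite !mxE.
  rewrite -kP // ffunE mulr_natr (inj_eq s_inj).
  by case: eqVneq => [->|].
have dVW : \det (varchenko K s) * \det W
    = \prod_(Y <- flatten [seq l j | j : 'I_(size s)]) (1 - face_weight K Y).
  rewrite -det_mulmx VW det_diag big_flatten big_map big_enum /=.
  by apply: eq_bigr => j _; rewrite mxE.
have lL : {subset flatten [seq l j | j : 'I_(size s)] <= [set Y in L | zero_set Y != set0]}.
  by move=> Y /flattenP[_ /mapP[j _ ->] Yl]; apply: (lP j).1.
have [|l' [u [l'l u_unit dE]]] := divisor_of_prime_product _ dVW.
  by move=> Y /lL; rewrite inE => /andP[_ /face_factor_prime].
have l'L : {subset l' <= [set Y in L | zero_set Y != set0]} by move=> Y /l'l/lL.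
suff u1 : u = 1.
  (* At a tope the factor is 0, but [l'] contains no tope, so the exponent is 0 and the power is
     1. *)
  exists (fun Y => count_mem Y l'); rewrite dE u1 mul1r; apply: prod_seq_count.
  by move=> Y /l'L/setIdP[].
(* Units of the polynomial ring are constants, so evaluation at 0 determines [u]. *)
have /andP[/eqP uE _] : (u == (u@_0%MM)%:MP) && (u@_0%MM \is a GRing.unit) := u_unit.
have : meval (fun=> 0) (\det (varchenko K s)) = 1.
  rewrite -det_map_mx -(det1 _ (size s)); congr (\det _); apply/matrixP => i j.
  rewrite !mxE /= at0_entry; first last.
  - by move: (sT j); rewrite in_topes => /andP[].
  - by move: (sT i); rewrite in_topes => /andP[].
  by rewrite (inj_eq s_inj).
rewrite dE rmorphM rmorph_prod /= big_seq big1 ?mulr1 => [|Y /l'L/setIdP[_]]; last first.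
  exact: at0_face_factor.
by rewrite uE mevalC => ->.
Qed.
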